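(* For every integer $m\ge 0$ and all $x\in\mathbb{R}$, $$Q_{m}^{(0,0)}(x)=m!\sum_{n=0}^{[m/2]}(-1)^n x^{2n}\,C_{m-2n}^{(n+1)}(-x),$$ where $[m/2]$ denotes the integer part of $m/2$ and $C_l^{(\lambda)}$ are the Gegenbauer polynomials.
   Context: Throughout $x$ is a real variable, $\alpha,a$ are real parameters, $\sigma(x)=1+x^2$, and $\cot^{-1}:\mathbb{R}\to(0,\pi)$ is the smooth branch, so that $\frac{d}{dx}\cot^{-1}x=-1/\sigma(x)$. For integers $l\ge 0$ put $w_l(x)=\sigma(x)^{-(l+a+1)}e^{-\alpha\cot^{-1}x}=\sigma(x)^{-l}w_0(x)$. Define $P_l^{(a,\alpha)}(x)=\frac{1}{w_l(x)}\frac{d^l}{dx^l}[w_l(x)\sigma(x)^l]=\frac{\sigma(x)^l}{w_0(x)}\frac{d^l w_0(x)}{dx^l}$. The complementary (Romanovski) polynomials $Q_\nu^{(\alpha,-a)}$, with $Q_0^{(\alpha,-a)}\equiv 1$, are defined by the Rodrigues representation $P_l^{(a,\alpha)}(x)=\frac{1}{w_l(x)}\frac{d^{l-\nu}}{dx^{l-\nu}}[\sigma(x)^{l-\nu}w_l(x)Q_\nu^{(\alpha,-a)}(x)]$ for all integers $0\le\nu\le l$ (the case $l=\nu$ reads $Q_\nu^{(\alpha,-a)}=P_\nu^{(a,\alpha)}$). $Q_m^{(0,0)}$ is the case $\alpha=0$, $a=0$. The Gegenbauer polynomials are defined by $(1-2xy+y^2)^{-\lambda}=\sum_{l=0}^{\infty}C_l^{(\lambda)}(x)y^l$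 (power series in $y$ near $0$). *)

(* Defs.v *)
(* Written over Stdlib's real numbers and Coquelicot. *)
From Stdlib Require Import Reals Lra Lia.
From Coquelicot Require Import Coquelicot.
Open Scope R_scope.

Definition sigma (x : R) : R := 1 + x ^ 2.

(* The branch of the inverse cotangent with values in (0, PI). *)
Definition acot (x : R) : R := PI / 2 - atan x.

Lemma acot_bound (x : R) : 0 < acot x < PI.
Proof. unfold acot; generalize (atan_bound x); lra. Qed.

Lemma cot_acot (x : R) : cos (acot x) / sin (acot x) = x.
Proof.
unfold acot; rewrite cos_shift, sin_shift; exact (tan_atan x).
Qed.

Definition weight (a alpha : R) (l : nat) (x : R) : R :=
  Rpower (sigma x) (- (INR l + a + 1)) * exp (- alpha * acot x).

Definition romanovskiP (a alpha : R) (l : nat) (x : R) : R :=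
  / weight a alpha l x *
  Derive_n (fun t => weight a alpha l t * sigma t ^ l) l x.

(* [Q nu] is the polynomial whose superscript is (alpha, -a): the second
   argument below is [a] itself. *)
Definition is_complementary_romanovski
    (alpha a : R) (Q : nat -> R -> R) : Prop :=
  (forall x : R, Q 0%nat x = 1) /\
  (forall (l nu : nat) (x : R), (nu <= l)%nat ->
     romanovskiP a alpha l x =
     / weight a alpha l x *
     Derive_n
       (fun t => sigma t ^ (l - nu) * weight a alpha l t * Q nu t)
       (l - nu) x).

(* [Rpower] is the real power here: for [y] near 0 its base is positive. *)
Definition is_gegenbauer (lambda : R) (C : nat -> R -> R) : Prop :=
  forall x : R,
    locally 0 (fun y : R =>
      is_pseries (fun l => C l x) y
        (Rpower (1 - 2 * x * y + y ^ 2) (- lambda))).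

(* Both predicates are satisfiable for all real parameters, so that statements
   quantified over their solutions are not vacuous. *)

Lemma sigma_pos (x : R) : 0 < sigma x.
Proof. unfold sigma; nra. Qed.

Lemma weight_pos (a alpha : R) (l : nat) (x : R) : 0 < weight a alpha l x.
Proof. apply Rmult_lt_0_compat; apply exp_pos. Qed.

Lemma weight_sigma (a alpha : R) (l nu : nat) (x : R) :
  weight a alpha (l + nu) x * sigma x ^ l = weight a alpha nu x.
Proof.
unfold weight; rewrite <- (Rpower_pow l _ (sigma_pos x)).
replace (- (INR nu + a + 1)) with (- (INR (l + nu) + a + 1) + INR l)
  by (rewrite plus_INR; ring).
rewrite Rpower_plus; ring.
Qed.

Lemma complementary_romanovski_exists (alpha a : R) :
  exists Q : nat -> R -> R, is_complementary_romanovski alpha a Q.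
Proof.
assert (W0 : forall l x,
  weight a alpha l x * sigma x ^ l = weight a alpha 0 x).
{ intros l x; rewrite <- (weight_sigma a alpha l 0 x).
  now rewrite Nat.add_0_r. }
exists (romanovskiP a alpha); split.
- intros x; unfold romanovskiP; simpl; rewrite Rmult_1_r.
  apply Rinv_l, Rgt_not_eq, weight_pos.
- intros l nu x Hle; unfold romanovskiP at 1; f_equal.
  rewrite (Derive_n_ext _ _ l x (W0 l)).
  replace l with ((l - nu) + nu)%nat at 1 by lia.
  rewrite <- Derive_n_comp; apply Derive_n_ext; intros t.
  unfold romanovskiP; rewrite (Derive_n_ext _ _ nu t (W0 nu)).
  assert (H := weight_sigma a alpha (l - nu) nu t).
  replace (l - nu + nu)%nat with l in H by lia.
  rewrite (Rmult_comm (sigma t ^ _)), H; field.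
  apply Rgt_not_eq, weight_pos.
Qed.

Fixpoint gegenbauer_pair (lambda x : R) (n : nat) : R * R :=
  match n with
  | O => (1, 2 * lambda * x)
  | S p =>
      let (u, v) := gegenbauer_pair lambda x p in
      (v, (2 * x * (INR p + 1 + lambda) * v - (INR p + 2 * lambda) * u)
          / (INR p + 2))
  end.

Lemma gegenbauer_exists (lambda : R) :
  exists C : nat -> R -> R, is_gegenbauer lambda C.
Proof.
exists (fun l x => fst (gegenbauer_pair lambda x l)); intros x.
set (c := fun l => fst (gegenbauer_pair lambda x l)).
assert (c0 : c 0%nat = 1) by reflexivity.
assert (c1 : c 1%nat = 2 * lambda * x) by reflexivity.
assert (cS : forall n, (INR n + 2) * c (S (S n)) =
  2 * x * (INR n + 1 + lambda) * c (S n) - (INR n + 2 * lambda) * c n).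
{ intros n; unfold c; simpl.
  destruct (gegenbauer_pair lambda x n) as [u v]; simpl.
  field; generalize (pos_INR n); lra. }
clearbody c.
set (K := (2 * Rabs x + 1) * (1 + Rabs lambda)).
assert (Hx := Rabs_pos x); assert (Hl := Rabs_pos lambda).
assert (HK1 : 2 * Rabs x + 1 <= K) by (unfold K; nra).
assert (Kp : forall n, 0 < K ^ n) by (intros n; apply pow_lt; lra).
assert (bnd : forall n, Rabs (c n) <= K ^ n /\ Rabs (c (S n)) <= K ^ S n).
{ induction n as [|n [IH0 IH1]].
  - rewrite c0, c1, !Rabs_mult, Rabs_R1, (Rabs_pos_eq 2) by lra.
    simpl; unfold K; split; nra.
  - split; [exact IH1|].
    assert (Hn := pos_INR n).
    assert (E : (INR n + 2) * Rabs (c (S (S n))) <=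
                (INR n + 2) * K ^ S (S n)).
    { replace ((INR n + 2) * Rabs (c (S (S n))))
        with (Rabs ((INR n + 2) * c (S (S n))))
        by (rewrite Rabs_mult, (Rabs_pos_eq (INR n + 2)); lra).
      rewrite cS.
      eapply Rle_trans; [apply Rabs_triang|].
      rewrite Rabs_Ropp, !Rabs_mult, (Rabs_pos_eq 2) by lra.
      assert (A1 : Rabs (INR n + 1 + lambda) <=
                   (INR n + 2) * (1 + Rabs lambda)).
      { eapply Rle_trans; [apply Rabs_triang|].
        rewrite Rabs_pos_eq by lra; nra. }
      assert (A2 : Rabs (INR n + 2 * lambda) <=
                   (INR n + 2) * (1 + Rabs lambda)).
      { eapply Rle_trans; [apply Rabs_triang|].
        rewrite Rabs_pos_eq, Rabs_mult, (Rabs_pos_eq 2) by lra; nra. }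
      assert (B : Rabs (c n) <= K ^ S n)
        by (specialize (Kp n); simpl; nra).
      set (T := (INR n + 2) * (1 + Rabs lambda)) in *.
      apply Rle_trans with (2 * Rabs x * T * K ^ S n + T * K ^ S n).
      - apply Rplus_le_compat.
        + apply Rmult_le_compat; try apply Rabs_pos; try exact IH1.
          * apply Rmult_le_pos; [lra|apply Rabs_pos].
          * apply Rmult_le_compat_l; lra.
        + apply Rmult_le_compat; try apply Rabs_pos; assumption.
      - right; unfold T, K; simpl; ring. }
    apply Rmult_le_reg_l with (INR n + 2); lra. }
assert (Hr : 0 < / K) by (apply Rinv_0_lt_compat; lra).
assert (rad : forall y, Rabs y < / K -> Rbar_lt (Rabs y) (CV_radius c)).
{ intros y Hy; apply Rbar_lt_le_trans with (Finite (/ K)); [exact Hy|].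
  apply (proj1 (CV_radius_bounded c)); exists 1; intros n.
  rewrite Rabs_mult, <- RPow_abs, (Rabs_pos_eq (/ K)), pow_inv by lra.
  destruct (bnd n) as [Hn _]; specialize (Kp n).
  apply Rmult_le_reg_r with (K ^ n); [exact Kp|].
  rewrite Rmult_assoc, Rinv_l; lra. }
assert (pos : forall y, Rabs y < / K -> 0 < 1 - 2 * x * y + y ^ 2).
{ intros y Hy.
  assert (Rabs (x * y) < / 2).
  { rewrite Rabs_mult; assert (Hy0 := Rabs_pos y).
    assert (K * Rabs y < 1).
    { apply Rmult_lt_reg_l with (/ K); [exact Hr|].
      rewrite <- Rmult_assoc, Rinv_l; lra. }
    nra. }
  generalize (Rle_abs (x * y)) (pow2_ge_0 y); lra. }
set (F := PSeries c).
assert (ode : forall y, Rabs y < / K ->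
  (1 - 2 * x * y + y ^ 2) * PSeries (PS_derive c) y =
  2 * lambda * (x - y) * F y).
{ intros y Hy; assert (R0 := rad y Hy).
  assert (Ec := CV_radius_inside _ _ R0).
  assert (Ed := ex_pseries_derive _ _ R0).
  set (D := PS_derive c) in *.
  assert (sc : forall (k : R) (b : nat -> R),
    ex_pseries b y -> ex_pseries (PS_scal k b) y)
    by (intros k b Hb; apply (ex_pseries_scal (K := R_AbsRing) k b y);
        [apply Rmult_comm|exact Hb]).
  assert (Ed1 : ex_pseries (PS_incr_1 D) y)
    by (apply ex_pseries_incr_1; exact Ed).
  assert (Ed2 : ex_pseries (PS_incr_1 (PS_incr_1 D)) y)
    by (apply ex_pseries_incr_1; exact Ed1).
  assert (Ec1 : ex_pseries (PS_incr_1 c) y)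
    by (apply ex_pseries_incr_1; exact Ec).
  assert (EL : PSeries (PS_plus (PS_plus D (PS_incr_1 (PS_incr_1 D)))
                                (PS_scal (2 * lambda) (PS_incr_1 c))) y =
               PSeries (PS_plus (PS_scal (2 * x) (PS_incr_1 D))
                                (PS_scal (2 * lambda * x) c)) y).
  { apply PSeries_ext; intros n.
    unfold PS_plus, PS_scal, D, PS_derive, plus, scal; simpl.
    unfold mult; simpl.
    destruct n as [|[|n]]; unfold PS_incr_1; simpl PS_incr_n.
    - rewrite c0, c1; unfold zero; simpl; ring.
    - assert (H := cS 0%nat); simpl in H |- *.
      rewrite c0, c1 in *; unfold zero; simpl; lra.
    - assert (H := cS (S n)); change (match n with O => 1 | S _ => INR n + 1 end)
        with (INR (S n)); rewrite !S_INR in *; lra. }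
  rewrite !PSeries_plus, !PSeries_scal, !PSeries_incr_1 in EL;
    auto using ex_pseries_plus.
  fold F in EL; lra. }
assert (main : forall y, Rabs y < / K ->
  F y * Rpower (1 - 2 * x * y + y ^ 2) lambda = 1).
{ set (G := fun y => F y * Rpower (1 - 2 * x * y + y ^ 2) lambda).
  assert (dG : forall y, Rabs y < / K -> is_derive G y 0).
  { intros y Hy; assert (P := pos y Hy).
    assert (dF := is_derive_PSeries c y (rad y Hy)); fold F in dF.
    assert (dR : is_derive (fun t => Rpower (1 - 2 * x * t + t ^ 2) lambda) y
      ((2 * y - 2 * x) *
       (lambda * Rpower (1 - 2 * x * y + y ^ 2) (lambda - 1)))).
    { apply (is_derive_comp (fun u => Rpower u lambda)
               (fun t => 1 - 2 * x * t + t ^ 2)).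
      - apply is_derive_Reals, derivable_pt_lim_power; exact P.
      - auto_derive; [exact I|ring]. }
    assert (dFR := Derive.is_derive_mult _ _ _ _ _ dF dR).
    assert (E := ode y Hy).
    evar_last; [exact dFR|cbv beta].
    assert (S1 : Rpower (1 - 2 * x * y + y ^ 2) lambda =
      Rpower (1 - 2 * x * y + y ^ 2) (lambda - 1) * (1 - 2 * x * y + y ^ 2)).
    { rewrite <- (Rpower_1 (1 - 2 * x * y + y ^ 2)) at 3 by exact P.
      rewrite <- Rpower_plus; f_equal; ring. }
    rewrite S1.
    set (p := Rpower (1 - 2 * x * y + y ^ 2) (lambda - 1)).
    transitivity (p * ((1 - 2 * x * y + y ^ 2) * PSeries (PS_derive c) y -
                       2 * lambda * (x - y) * F y)); [ring|].
    rewrite E; ring. }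
  intros y Hy; change (G y = 1).
  assert (G0 : G 0 = 1).
  { unfold G, F; rewrite PSeries_0, c0.
    replace (1 - 2 * x * 0 + 0 ^ 2) with 1 by ring.
    unfold Rpower; rewrite ln_1, Rmult_0_r, exp_0; ring. }
  assert (V : Rabs (G y - G 0) <= 0 * Rabs (y - 0)).
  { apply (bounded_variation G (fun _ => 0)); intros t Ht.
    rewrite !Rminus_0_r in Ht; split.
    - apply dG; lra.
    - rewrite Rabs_R0; lra. }
  rewrite Rmult_0_l in V.
  assert (V0 := Rabs_pos (G y - G 0)).
  destruct (Req_dec (G y - G 0) 0) as [Z|Z]; [lra|].
  apply Rabs_pos_lt in Z; lra. }
exists (mkposreal _ Hr); intros y Hy.
assert (Hy' : Rabs y < / K).
{ revert Hy; unfold ball; simpl; unfold AbsRing_ball, abs, minus, plus, opp.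
  simpl; now rewrite Ropp_0, Rplus_0_r. }
assert (M := main y Hy').
replace (Rpower (1 - 2 * x * y + y ^ 2) (- lambda)) with (F y).
- apply PSeries_correct, CV_radius_inside, rad; exact Hy'.
- rewrite Rpower_Ropp.
  apply Rmult_eq_reg_r with (Rpower (1 - 2 * x * y + y ^ 2) lambda).
  + rewrite M, Rinv_l; [reflexivity|apply Rgt_not_eq, exp_pos].
  + apply Rgt_not_eq, exp_pos.
Qed.

(* Main.v *)
Require Import Defs.
From Stdlib Require Import Reals Factorial Lra Lia.
From Coquelicot Require Import Coquelicot.
(* The name sigma is also that of a finite sum over the reals. *)
Import Defs.
Open Scope R_scope.

(** Both sides, divided by [m!], are the coefficient of [y ^ m] in
    [1 / (1 + 2 x y + (1 + x ^ 2) y ^ 2)].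

    For [alpha = a = 0] the weight [w_0] is [1 / sigma], so that
    [Q_m = sigma ^ (m + 1) (1 / sigma)^(m)], and the generating function of
    [Q_m / m!] is, by Taylor's formula,
    [sigma (x) / sigma (x + sigma (x) y) = 1 / (1 + 2 x y + sigma (x) y ^ 2)].
    On the other side, put [u = 1 + 2 x y + y ^ 2] and expand
    [1 / (u + x ^ 2 y ^ 2)] as the geometric series
    [sum_n (-1) ^ n x ^ (2 n) y ^ (2 n) / u ^ (n + 1)]; the coefficients of
    [1 / u ^ (n + 1)] are the Gegenbauer polynomials at [- x].

    The proof replaces the two-variable series by the three-term recurrence
    [c_(m + 2) + 2 x c_(m + 1) + (1 + x ^ 2) c_m = 0] that the common
    denominator imposes.  [romanovski0] is defined by this recurrence;
    [Derive_n_inv_sigma] identifies it with the derivatives of [1 / sigma], and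
    [gegenbauer_sum_recurrence] shows that the Gegenbauer sum satisfies it.
    The latter rests on [gegenbauer_quad_mul]: multiplication of power series
    by [1 - 2 z y + y ^ 2] lowers the Gegenbauer parameter by one, so that the
    sum telescopes into [- x ^ 2] times its value two steps before. *)

(** * Derivatives of the reciprocal of sigma *)

Fixpoint romanovski0 (m : nat) (x : R) : R :=
  match m with
  | O => 1
  | S p =>
      match p with
      | O => - 2 * x
      | S q => - 2 * x * romanovski0 p x - sigma x * romanovski0 q x
      end
  end.

Lemma romanovski0_SS (m : nat) (x : R) :
  romanovski0 (S (S m)) x =
  - 2 * x * romanovski0 (S m) x - sigma x * romanovski0 m x.
Proof. reflexivity. Qed.

(** For [G = 1 / (1 + 2 x y + sigma (x) y ^ 2)], both [dG/dx] and
    [- d(y ^ 2 G)/dy] equal [- 2 (y + x y ^ 2) G ^ 2]; this is the equality of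
    the coefficients of [y ^ (m + 1)]. *)
Lemma is_derive_romanovski0 (m : nat) (x : R) :
  is_derive (romanovski0 (S m)) x (- (INR m + 2) * romanovski0 m x).
Proof.
enough (H : is_derive (romanovski0 (S m)) x (- (INR m + 2) * romanovski0 m x) /\
  is_derive (romanovski0 (S (S m))) x
    (- (INR (S m) + 2) * romanovski0 (S m) x)) by apply H.
induction m as [|m [IH0 IH1]].
- split; simpl; unfold sigma; auto_derive; auto; ring.
- split; [exact IH1|].
  apply (is_derive_ext (fun t => - 2 * t * romanovski0 (S (S m)) t
                                 - sigma t * romanovski0 (S m) t));
    [intros t; symmetry; apply romanovski0_SS|].
  set (f := romanovski0 (S (S m))) in *; set (g := romanovski0 (S m)) in *.
  unfold sigma; auto_derive; [split; [|split]; eauto; eexists; eassumption|].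
  assert (Dg : Derive (fun t => g t) x = _) by exact (is_derive_unique _ _ _ IH0).
  assert (Df : Derive (fun t => f t) x = _) by exact (is_derive_unique _ _ _ IH1).
  rewrite Dg, Df.
  unfold f; rewrite romanovski0_SS; fold g; unfold sigma; rewrite !S_INR; ring.
Qed.

Lemma Derive_n_inv_sigma (m : nat) (x : R) :
  Derive_n (fun t => / sigma t) m x =
  INR (fact m) * romanovski0 m x / sigma x ^ S m.
Proof.
revert x; induction m as [|m IH]; intros x.
- assert (P := sigma_pos x); simpl; field; lra.
- change (Derive_n (fun t => / sigma t) (S m) x)
    with (Derive (Derive_n (fun t => / sigma t) m) x).
  rewrite (Derive_ext _ _ x IH); apply is_derive_unique.
  assert (P := sigma_pos x).
  assert (Pm : sigma x ^ m <> 0) by (apply pow_nonzero; lra).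
  assert (E : exists d, is_derive (romanovski0 m) x d /\
    sigma x * d - 2 * (INR m + 1) * x * romanovski0 m x =
    (INR m + 1) * romanovski0 (S m) x).
  { destruct m as [|m].
    - exists 0; split; [apply (is_derive_const 1)|simpl; ring].
    - exists (- (INR m + 2) * romanovski0 m x); split.
      + apply is_derive_romanovski0.
      + rewrite romanovski0_SS, !S_INR; ring. }
  destruct E as [d [Hd E]].
  assert (dS : is_derive (fun t => sigma t ^ S m) x
                 (2 * x * (INR m + 1) * sigma x ^ m)).
  { unfold sigma; auto_derive; [exact I|].
    change (Init.Nat.pred (S m)) with m.
    change (match m with O => 1 | S _ => INR m + 1 end) with (INR (S m)).
    rewrite S_INR; simpl; ring. }
  evar_last.
  { apply is_derive_div; [|exact dS|apply pow_nonzero; lra].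
    apply is_derive_scal; exact Hd. }
  change (fact (S m)) with (S m * fact m)%nat.
  rewrite mult_INR, S_INR.
  replace ((INR m + 1) * INR (fact m) * romanovski0 (S m) x)
    with (INR (fact m) * ((INR m + 1) * romanovski0 (S m) x)) by ring.
  rewrite <- E; simpl; field; split; [exact Pm|lra].
Qed.

(** The Rodrigues formula with [l = nu] gives [Q_m] alone on the right, and for
    [alpha = a = 0] the weight [w_m] is [sigma ^ - (m + 1)]. *)
Lemma complementary_romanovski0 (Q : nat -> R -> R)
  (HQ : is_complementary_romanovski 0 0 Q) (m : nat) (x : R) :
  Q m x = INR (fact m) * romanovski0 m x.
Proof.
destruct HQ as [_ HQ]; specialize (HQ m m x (le_n m)).
rewrite Nat.sub_diag in HQ; simpl in HQ.
assert (W : forall t, weight 0 0 m t * sigma t ^ m = / sigma t).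
{ intros t; rewrite <- (Nat.add_0_r m) at 1; rewrite weight_sigma.
  unfold weight; rewrite Ropp_0, Rmult_0_l, exp_0, Rmult_1_r; simpl.
  rewrite Rpower_Ropp, !Rplus_0_l, Rpower_1; [reflexivity|apply sigma_pos]. }
unfold romanovskiP in HQ.
rewrite (Derive_n_ext _ _ m x W), Derive_n_inv_sigma in HQ.
assert (P := sigma_pos x); assert (Pw := weight_pos 0 0 m x).
assert (Pm : sigma x ^ m <> 0) by (apply pow_nonzero; lra).
transitivity (/ weight 0 0 m x * (1 * weight 0 0 m x * Q m x));
  [field; lra|].
rewrite <- HQ.
assert (Ew : weight 0 0 m x = / (sigma x ^ S m)).
{ apply Rmult_eq_reg_r with (sigma x ^ m); [|exact Pm].
  rewrite W; simpl; field; split; [exact Pm|lra]. }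
rewrite Ew; simpl; field; split; [exact Pm|lra].
Qed.

(** * Uniqueness of power series coefficients *)

Lemma CV_radius_pos (a : nat -> R) (f : R -> R) :
  locally 0 (fun y => is_pseries a y (f y)) -> Rbar_lt 0 (CV_radius a).
Proof.
intros [e He].
assert (Pe := cond_pos e).
assert (H : is_pseries a (e / 2) (f (e / 2))).
{ apply He; unfold ball; simpl; unfold AbsRing_ball, abs, minus, plus, opp.
  simpl; rewrite Ropp_0, Rplus_0_r, Rabs_pos_eq; lra. }
apply Rbar_lt_le_trans with (Finite (Rabs (e / 2))).
- simpl; rewrite Rabs_pos_eq; lra.
- apply Rbar_not_lt_le; intros Hlt; apply (CV_disk_outside _ _ Hlt).
  apply ex_series_lim_0; exists (f (e / 2)); apply is_pseries_R; exact H.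
Qed.

Lemma pseries_coef_unique (a b : nat -> R) (f : R -> R) (n : nat) :
  locally 0 (fun y => is_pseries a y (f y)) ->
  locally 0 (fun y => is_pseries b y (f y)) -> a n = b n.
Proof.
intros Ha Hb; apply PSeries_ext_recip.
- exact (CV_radius_pos a f Ha).
- exact (CV_radius_pos b f Hb).
- generalize (filter_and _ _ Ha Hb); apply filter_imp; intros y [Ya Yb].
  now rewrite (is_pseries_unique _ _ _ Ya), (is_pseries_unique _ _ _ Yb).
Qed.

(** * Multiplication of power series by the Gegenbauer quadratic *)

(** Coefficients in [y] of [(1 - 2 z y + y ^ 2) a (y)]. *)
Definition quad_mul (z : R) (a : nat -> R) : nat -> R :=
  PS_plus (PS_plus a (PS_scal (- 2 * z) (PS_incr_1 a)))
          (PS_incr_1 (PS_incr_1 a)).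

Lemma is_pseries_quad_mul (z : R) (a : nat -> R) (y l : R) :
  is_pseries a y l ->
  is_pseries (quad_mul z a) y ((1 - 2 * z * y + y ^ 2) * l).
Proof.
intros H.
assert (H1 := is_pseries_incr_1 a y l H).
assert (H2 := is_pseries_incr_1 _ y _ H1).
evar_last.
- apply is_pseries_plus; [apply is_pseries_plus|]; [exact H| |exact H2].
  apply is_pseries_scal; [apply Rmult_comm|exact H1].
- unfold plus, scal; simpl; unfold mult; simpl; ring.
Qed.

Lemma quad_mul_SS (z : R) (a : nat -> R) (k : nat) :
  quad_mul z a (S (S k)) = a (S (S k)) - 2 * z * a (S k) + a k.
Proof.
unfold quad_mul, PS_plus, PS_scal, plus, scal; simpl.
unfold mult; simpl; ring.
Qed.

Lemma quad_mul_incr_1 (z : R) (a : nat -> R) (k : nat) :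
  quad_mul z (PS_incr_1 a) k = PS_incr_1 (quad_mul z a) k.
Proof.
destruct k as [|[|k]]; unfold quad_mul, PS_plus, PS_scal, plus, scal; simpl;
  unfold mult, zero; simpl; ring.
Qed.

Lemma quad_mul_incr_n (z : R) (a : nat -> R) (n k : nat) :
  quad_mul z (PS_incr_n a n) k = PS_incr_n (quad_mul z a) n k.
Proof.
revert k; induction n as [|n IH]; intros k; [reflexivity|].
change (quad_mul z (PS_incr_1 (PS_incr_n a n)) k =
        PS_incr_1 (PS_incr_n (quad_mul z a) n) k).
rewrite quad_mul_incr_1; destruct k; [reflexivity|apply IH].
Qed.

Lemma PS_incr_n_ext (a b : nat -> R) (n k : nat) :
  (forall l, a l = b l) -> PS_incr_n a n k = PS_incr_n b n k.
Proof.
intros E; rewrite !PS_incr_n_simplify.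
destruct Compare_dec.le_lt_dec; auto.
Qed.

Lemma gegenbauer_base_pos (z : R) :
  locally 0 (fun y => 0 < 1 - 2 * z * y + y ^ 2).
Proof.
assert (Cn : continuous (fun y => 1 - 2 * z * y + y ^ 2) 0).
{ apply (ex_derive_continuous (fun y => 1 - 2 * z * y + y ^ 2)).
  auto_derive; exact I. }
apply Cn, (open_gt 0); lra.
Qed.

(** The generating functions satisfy
    [(1 - 2 z y + y ^ 2) (1 - 2 z y + y ^ 2)^(-(lambda + 1))
     = (1 - 2 z y + y ^ 2)^(-lambda)]. *)
Lemma gegenbauer_quad_mul (lambda : R) (C C' : nat -> R -> R)
  (HC : is_gegenbauer lambda C) (HC' : is_gegenbauer (lambda + 1) C')
  (z : R) (l : nat) :
  quad_mul z (fun l => C' l z) l = C l z.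
Proof.
apply (pseries_coef_unique _ (fun l => C l z)
         (fun y => Rpower (1 - 2 * z * y + y ^ 2) (- lambda))); [|apply HC].
generalize (filter_and _ _ (HC' z) (gegenbauer_base_pos z)).
apply filter_imp; intros y [Hy Py].
evar_last; [exact (is_pseries_quad_mul z _ y _ Hy)|].
replace (- lambda) with (1 + - (lambda + 1)) by ring.
now rewrite Rpower_plus, (Rpower_1 _ Py).
Qed.

(** For [lambda = 0] the generating function is the constant [1]. *)
Lemma gegenbauer_0 (C : nat -> R -> R) (HC : is_gegenbauer 0 C)
  (z : R) (l : nat) :
  C l z = match l with O => 1 | S _ => 0 end.
Proof.
apply (pseries_coef_unique (fun l => C l z)
         (fun l => match l with O => 1 | S _ => 0 end) (fun _ => 1)).
- generalize (HC z); apply filter_imp; intros y Hy.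
  evar_last; [exact Hy|].
  unfold Rpower; now rewrite Ropp_0, Rmult_0_l, exp_0.
- apply filter_forall; intros y; apply is_pseries_R.
  apply (is_series_decr_1 (K := R_AbsRing) (V := R_NormedModule)).
  evar_last; [apply (is_series_ext (fun _ => 0));
              [intros n; simpl; ring|]|].
  + apply is_series_Reals; intros e He; exists 0%nat; intros n _.
    rewrite sum_eq_R0 by reflexivity.
    unfold R_dist; rewrite Rminus_diag, Rabs_R0; exact He.
  + unfold plus, opp; simpl; ring.
Qed.

(** * The Gegenbauer sum *)

Section GegenbauerSum.

Variable C : R -> nat -> R -> R.
Hypothesis HC : forall lambda : R, is_gegenbauer lambda (C lambda).
Variable x : R.

(** Coefficients in [y] of [y ^ (2 n) (1 + 2 x y + y ^ 2) ^ - (n + 1)].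
    Unlike the subtraction [m - 2 n], the shift is zero for [m < 2 n], so that
    sums over [n] may be extended beyond [m / 2]. *)
Definition shifted_gegenbauer (n : nat) : nat -> R :=
  PS_incr_n (fun l => C (INR (n + 1)) l (- x)) (2 * n).

Definition gegenbauer_sum (N m : nat) : R :=
  sum_f_R0 (fun n => (-1) ^ n * x ^ (2 * n) * shifted_gegenbauer n m) N.

Lemma gegenbauer_sum_truncate (m N : nat) :
  (m / 2 <= N)%nat ->
  gegenbauer_sum N m =
  sum_f_R0
    (fun n => (-1) ^ n * x ^ (2 * n) * C (INR (n + 1)) (m - 2 * n)%nat (- x))
    (m / 2)%nat.
Proof.
assert (Hm := Nat.div_mod_eq m 2).
assert (Hm' := Nat.mod_upper_bound m 2 ltac:(lia)).
intros HN; transitivity (gegenbauer_sum (m / 2) m).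
- unfold gegenbauer_sum.
  destruct (Nat.eq_dec (m / 2) N) as [E|E]; [now rewrite <- E|].
  rewrite (tech2 _ (m / 2) N) by lia.
  rewrite (sum_eq_R0 _ (N - S (m / 2))); [ring|].
  intros n _; unfold shifted_gegenbauer; rewrite PS_incr_n_simplify.
  destruct Compare_dec.le_lt_dec; [lia|apply Rmult_0_r].
- apply sum_eq; intros n Hn; unfold shifted_gegenbauer.
  rewrite PS_incr_n_simplify.
  destruct Compare_dec.le_lt_dec; [reflexivity|lia].
Qed.

Lemma quad_mul_shifted_gegenbauer (n k : nat) :
  quad_mul (- x) (shifted_gegenbauer n) k =
  PS_incr_n (fun l => C (INR n) l (- x)) (2 * n) k.
Proof.
unfold shifted_gegenbauer; rewrite quad_mul_incr_n.
apply PS_incr_n_ext; intros l.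
apply (gegenbauer_quad_mul (INR n) _ (C (INR (n + 1)))); [apply HC|].
rewrite plus_INR; apply HC.
Qed.

Lemma quad_mul_gegenbauer_sum (N m : nat) :
  gegenbauer_sum N (S (S m)) + 2 * x * gegenbauer_sum N (S m)
    + gegenbauer_sum N m =
  sum_f_R0 (fun n => (-1) ^ n * x ^ (2 * n) *
                     quad_mul (- x) (shifted_gegenbauer n) (S (S m))) N.
Proof.
unfold gegenbauer_sum; rewrite scal_sum, <- !sum_plus.
apply sum_eq; intros n _; rewrite quad_mul_SS; ring.
Qed.

(** Multiplied by [1 + 2 x y + y ^ 2], the term of index [0] becomes [1], which
    has no coefficient of positive degree, and the term of index [n + 1]
    becomes [- x ^ 2 y ^ 2] times the term of index [n]. *)
Lemma gegenbauer_sum_recurrence (N m : nat) :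
  gegenbauer_sum (S N) (S (S m)) + 2 * x * gegenbauer_sum (S N) (S m)
    + gegenbauer_sum (S N) m = - x ^ 2 * gegenbauer_sum N m.
Proof.
rewrite quad_mul_gegenbauer_sum, decomp_sum by lia.
rewrite quad_mul_shifted_gegenbauer; simpl PS_incr_n.
rewrite (gegenbauer_0 (C (INR 0)) (HC 0)), Rmult_0_r, Rplus_0_l.
change (Init.Nat.pred (S N)) with N.
unfold gegenbauer_sum; rewrite scal_sum; apply sum_eq; intros n _.
rewrite quad_mul_shifted_gegenbauer; unfold shifted_gegenbauer.
replace (2 * S n)%nat with (S (S (2 * n))) by lia.
replace (n + 1)%nat with (S n) by lia.
change (PS_incr_n (fun l => C (INR (S n)) l (- x)) (S (S (2 * n))) (S (S m)))
  with (PS_incr_n (fun l => C (INR (S n)) l (- x)) (2 * n) m).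
rewrite <- !tech_pow_Rmult; ring.
Qed.

Lemma gegenbauer_sum_romanovski0 (m N : nat) :
  (m / 2 <= N)%nat -> gegenbauer_sum N m = romanovski0 m x.
Proof.
(* In degrees 0 and 1 only the index n = 0 contributes; its coefficients are
   read off from those of (1 + 2 x y + y^2) * 1 / (1 + 2 x y + y^2) = 1. *)
assert (C0 : C 1 0%nat (- x) = 1 /\ C 1 1%nat (- x) = - 2 * x).
{ assert (E := fun l => quad_mul_shifted_gegenbauer 0 l).
  assert (E0 := E 0%nat); assert (E1 := E 1%nat); simpl in E0, E1.
  rewrite (gegenbauer_0 (C 0) (HC 0)) in E0, E1.
  unfold quad_mul, PS_plus, PS_scal, plus, scal, shifted_gegenbauer in E0, E1.
  simpl in E0, E1; unfold mult, zero in E0, E1; simpl in E0, E1.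
  split; nra. }
destruct C0 as [C0 C1].
revert N.
enough (H : (forall N, (m / 2 <= N)%nat ->
               gegenbauer_sum N m = romanovski0 m x) /\
            (forall N, (S m / 2 <= N)%nat ->
               gegenbauer_sum N (S m) = romanovski0 (S m) x)) by apply H.
induction m as [|m [IH0 IH1]].
- split; intros N HN; rewrite gegenbauer_sum_truncate by exact HN; simpl;
    [rewrite C0|rewrite C1]; ring.
- split; [exact IH1|]; intros N HN.
  (* The recurrence relates two consecutive bounds, both of which must reach
     the terms that occur; m + 1 and m + 2 are large enough. *)
  transitivity (gegenbauer_sum (S (S m)) (S (S m))).
  { rewrite !gegenbauer_sum_truncate; [reflexivity| |exact HN].
    apply Nat.Div0.div_le_upper_bound; lia. }
  assert (R := gegenbauer_sum_recurrence (S m) m).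
  rewrite (IH1 (S (S m))), (IH0 (S (S m))), (IH0 (S m)) in R
    by (apply Nat.Div0.div_le_upper_bound; lia).
  rewrite romanovski0_SS; unfold sigma; lra.
Qed.

End GegenbauerSum.

Theorem theorem4p1 (Q : nat -> R -> R) (C : R -> nat -> R -> R)
  (HQ : is_complementary_romanovski 0 0 Q)
  (HC : forall lambda : R, is_gegenbauer lambda (C lambda))
  (m : nat) (x : R) :
  Q m x =
  INR (fact m) *
  sum_f_R0
    (fun n => (-1) ^ n * x ^ (2 * n) * C (INR (n + 1)) (m - 2 * n)%nat (- x))
    (m / 2)%nat.
Proof.
rewrite (complementary_romanovski0 Q HQ).
rewrite <- (gegenbauer_sum_truncate C x m (m / 2) (le_n _)).
now rewrite (gegenbauer_sum_romanovski0 C HC x m _ (le_n _)).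
Qed.
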